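(* Let $f:S_n\to\mathbb{Z}$ be a permutation statistic given by a fixed corner tree formula $f(\pi)=\sum_{T} c_T\,\#T(\pi)$ (a finite sum over corner trees $T$ with rational coefficients $c_T$). There exists an algorithm that, given a permutation $\pi\in S_n$, computes $f(\pi)$ in running time $\tilde{O}(n)$.
   Context: Permutations are written in one-line notation $\pi=\pi(1)\cdots\pi(n)$. A corner tree is a finite rooted tree whose root carries a special root label and whose other vertices are each labeled by one of SW, SE, NW, NE. An occurrence of a corner tree $T$ in $\pi\in S_n$ is a map $i:\mathrm{vertices}(T)\to\{1,\dots,n\}$ (not necessarily injective) such that for every non-root vertex $v$ with parent $p$: if the label of $v$ is SW or NW then $i(v)<i(p)$; if it is SE or NE then $i(v)>i(p)$; if it is SW or SE then $\pi(i(v))<\pi(i(p))$; if it is NW or NE then $\pi(i(v))>\pi(i(p))$. $\#T(\pi)$ denotes the number of occurrences of $T$ in $\pi$. A corner tree formula is a finite rational linear combination of such counts; the formula is fixed and $n\to\infty$. The notation $\tilde{O}(g(n))$ means $O(g(n)\log^c n)$ for some constant $c$. *)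

(* Defs.v *)
From HB Require Import structures.
From mathcomp Require Import all_boot all_order all_algebra all_fingroup.

Set Implicit Arguments.
Unset Strict Implicit.
Unset Printing Implicit Defensive.

Import Order.TTheory GRing.Theory Num.Theory.
Local Open Scope ring_scope.

(** * Corner trees *)

Inductive corner := SW | SE | NW | NE.

(* The special root label is [None]; the parent of the root is the root itself
   by convention, and [ct_rooted] makes the parent structure a rooted tree. *)
Record corner_tree := CornerTree {
  ct_vertex : finType;
  ct_root : ct_vertex;
  ct_parent : ct_vertex -> ct_vertex;
  ct_label : ct_vertex -> option corner;
  ct_parent_root : ct_parent ct_root = ct_root;
  ct_rooted : forall v, exists k, iter k ct_parent v = ct_root;
  ct_label_root : forall v, ct_label v = None <-> v = ct_root
}.

(* Position [i] lies in direction [d] of position [j] in the plot of [pi]. *)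
Definition in_corner n (pi : 'S_n) (d : corner) (i j : 'I_n) : bool :=
  match d with
  | SW => (i < j)%N && (pi i < pi j)%N
  | SE => (j < i)%N && (pi i < pi j)%N
  | NW => (i < j)%N && (pi j < pi i)%N
  | NE => (j < i)%N && (pi j < pi i)%N
  end.

Definition is_occurrence (T : corner_tree) n (pi : 'S_n)
    (i : {ffun ct_vertex T -> 'I_n}) : bool :=
  [forall v, if ct_label v is Some d
             then in_corner pi d (i v) (i (ct_parent v)) else true].

Definition occurrences (T : corner_tree) n (pi : 'S_n) : nat :=
  #|[set i | is_occurrence (T := T) pi i]|.

Definition corner_tree_formula := seq (rat * corner_tree).

Definition formula_value (F : corner_tree_formula) n (pi : 'S_n) : rat :=
  \sum_(cT <- F) cT.1 * (occurrences cT.2 pi)%:R.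

(** * Random access machines with logarithmic cost

   Structured programs over finitely many named registers and an
   integer-addressed memory, with the arithmetic and the positivity test of the
   Aho-Hopcroft-Ullman RAM.  Costs are logarithmic: every register index,
   address and value that is handled is charged its bit length, so large
   integers give no free computing power. *)

Inductive binop := Add | Sub | Mul | Div.

Inductive expr :=
  | Cst of int
  | Reg of nat
  | Mem of expr
  | Bin of binop & expr & expr.

(* [If e c1 c2] and [While e c] test whether the value of [e] is positive. *)
Inductive prog :=
  | Skip
  | SetReg of nat & expr
  | SetMem of expr & expr
  | Seq of prog & prog
  | If of expr & prog & prog
  | While of expr & prog.

Record state := State { regs : nat -> int; mem : int -> int }.

Definition set_reg (s : state) (x : nat) (z : int) : state :=
  State (fun y => if y == x then z else regs s y) (mem s).

Definition set_mem (s : state) (a z : int) : state :=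
  State (regs s) (fun b => if b == a then z else mem s b).

(* [Div] is Euclidean division, with value 0 when the divisor is 0. *)
Definition eval_op (o : binop) (x y : int) : int :=
  match o with
  | Add => x + y
  | Sub => x - y
  | Mul => x * y
  | Div => (x %/ y)%Z
  end.

Fixpoint eval (s : state) (e : expr) : int :=
  match e with
  | Cst z => z
  | Reg x => regs s x
  | Mem a => mem s (eval s a)
  | Bin o e1 e2 => eval_op o (eval s e1) (eval s e2)
  end.

Definition bitlen (z : int) : nat := (trunc_log 2 `|z|%N).+1.

Fixpoint eval_cost (s : state) (e : expr) : nat :=
  (bitlen (eval s e) +
   match e with
   | Cst _ => 0
   | Reg x => bitlen x%:Z
   | Mem a => eval_cost s a
   | Bin _ e1 e2 => eval_cost s e1 + eval_cost s e2
   end)%N.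

(* [exec p s t s']: started in [s], the program [p] halts in [s'] at cost [t]. *)
Inductive exec : prog -> state -> nat -> state -> Prop :=
  | exec_Skip s : exec Skip s 1%N s
  | exec_SetReg s x e :
      exec (SetReg x e) s (bitlen x%:Z + eval_cost s e)%N (set_reg s x (eval s e))
  | exec_SetMem s a e :
      exec (SetMem a e) s (eval_cost s a + eval_cost s e)%N
        (set_mem s (eval s a) (eval s e))
  | exec_Seq p q s t1 s1 t2 s2 :
      exec p s t1 s1 -> exec q s1 t2 s2 -> exec (Seq p q) s (t1 + t2)%N s2
  | exec_IfT e p q s t s' :
      0 < eval s e -> exec p s t s' -> exec (If e p q) s (eval_cost s e + t)%N s'
  | exec_IfF e p q s t s' :
      eval s e <= 0 -> exec q s t s' -> exec (If e p q) s (eval_cost s e + t)%N s'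
  | exec_WhileT e p s t1 s1 t2 s2 :
      0 < eval s e -> exec p s t1 s1 -> exec (While e p) s1 t2 s2 ->
      exec (While e p) s (eval_cost s e + t1 + t2)%N s2
  | exec_WhileF e p s :
      eval s e <= 0 -> exec (While e p) s (eval_cost s e) s.

Lemma exec_deterministic p s t1 s1 t2 s2 :
  exec p s t1 s1 -> exec p s t2 s2 -> t1 = t2 /\ s1 = s2.
Proof.
move=> h; elim: h t2 s2 => {p s t1 s1};
  intros; match goal with h : exec _ _ ?t ?s |- _ = ?t /\ _ = ?s =>
    inversion h; subst; clear h end;
  repeat match goal with
  | IH : (forall t2 s2, exec ?p ?s t2 s2 -> _), h : exec ?p ?s _ _ |- _ =>
      case: (IH _ _ h) => ? ?; subst; clear h IH
  | h : is_true (0 < ?x), h' : is_true (?x <= 0) |- _ =>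
      by move: h; rewrite ltNge h'
  end; by [].
Qed.

(** * Computing permutation statistics *)

Definition one_line n (pi : 'S_n) : seq nat := [seq (pi i).+1 | i <- enum 'I_n].

(* Register 0 holds n, memory cells 1..n hold pi(1), ..., pi(n), and all other
   registers and cells are 0. *)
Definition input_state n (pi : 'S_n) : state :=
  State (fun x => if x == 0%N then n%:Z else 0)
        (fun a => if a is Posz k.+1 then (nth 0%N (one_line pi) k)%:Z else 0).

(* The output is read off register 0; [t n] bounds the worst-case cost over all
   permutations of size [n]. *)
Definition computes_in_time (p : prog) (f : forall n, 'S_n -> int)
    (t : nat -> nat) : Prop :=
  forall n (pi : 'S_n), exists k s,
    [/\ exec p (input_state pi) k s, regs s 0%N = f n pi & (k <= t n)%N].

Definition softO (t g : nat -> nat) : Prop :=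
  exists C c N : nat, forall n : nat,
    (N <= n)%N -> (t n <= C * (g n * trunc_log 2 n ^ c))%N.

(* Main.v *)
Require Import Defs.
From HB Require Import structures.
From mathcomp Require Import all_boot all_order all_algebra all_fingroup.
From mathcomp Require Import zify ring.
(* Imported again so that [Mem] and [mem] denote the machine's memory rather than
   the collective predicates of ssrbool. *)
Import Defs.

Set Implicit Arguments.
Unset Strict Implicit.
Unset Printing Implicit Defensive.

Import Order.TTheory GRing.Theory Num.Theory.
Local Open Scope ring_scope.

(** The number of occurrences of a corner tree is computed by stripping leaves.
Give every vertex u a weight vector X_u on positions, initially constant 1, and
count maps with weight prod_u X_u(i(u)).  Removing a leaf v with parent p and label
d does not change the weighted count if X_p(i) is multiplied by the sum of X_v(j)
over all positions j in direction d of i; once only the root is left, the count is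
the sum of its weight vector.  After reflecting positions and values, all these
sums for one leaf are obtained by a single left-to-right sweep over the plot of the
permutation: a segment tree indexed by values answers a prefix-sum query and takes
one insertion per position, in O(log n) steps.

A fixed formula thus needs O(n log n) instructions.  All numbers occurring are at
most (n+2)^E for a constant E, so every instruction has logarithmic cost O(log n).
Rational coefficients are brought to a common denominator, by which the final
integer is divided. *)

(** * Logarithmic cost from unit cost *)

Lemma bitlen_gt0 z : (0 < bitlen z)%N. Proof. by []. Qed.

Lemma leq_bitlen x y : (`|x| <= `|y|)%N -> (bitlen x <= bitlen y)%N.
Proof. by move=> h; rewrite ltnS leq_trunc_log. Qed.

Lemma ltn_expn_bitlen z : (`|z| < 2 ^ bitlen z)%N.
Proof. exact: trunc_log_ltn. Qed.

Lemma bitlen_leq z k : (0 < k)%N -> (`|z| < 2 ^ k)%N -> (bitlen z <= k)%N.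
Proof.
move=> k0 h; rewrite /bitlen.
case: (posnP `|z|) => [->|z0]; first by rewrite trunc_log0.
rewrite -(ltn_exp2l _ _ (ltnSn 1)); apply: leq_ltn_trans h.
exact: trunc_logP.
Qed.

Lemma absz_divz_le x y : (`|(x %/ y)%Z| <= `|x|)%N.
Proof.
case: (eqVneq y 0) => [->|y0]; first by rewrite divz0.
have := divz_eq x y; have := modz_ge0 x y0; have := ltz_mod x y0.
by move: (x %/ y)%Z (x %% y)%Z => q r h1 h2 h3; nia.
Qed.

(** Multiplication adds bit lengths, a sum or difference needs at most one extra carry bit, and a
    quotient is no larger than its dividend. *)
Lemma bitlen_op o x y : (bitlen (eval_op o x y) <= bitlen x + bitlen y + 1)%N.
Proof.
have hx := ltn_expn_bitlen x; have hy := ltn_expn_bitlen y.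
apply: bitlen_leq; first by rewrite addn1.
have x0 : (0 < 2 ^ bitlen x)%N by rewrite expn_gt0.
have y0 : (0 < 2 ^ bitlen y)%N by rewrite expn_gt0.
have div_le := absz_divz_le x y.
rewrite !expnD expn1.
move: (2 ^ bitlen x)%N (2 ^ bitlen y)%N hx hy x0 y0 => a b hx hy x0 y0.
by case: o => /=; [nia | nia | rewrite abszM; nia | nia].
Qed.

(* The value of an expression is polynomial in the size of the data it reads,
   hence its bit length is linear in the bit length of that size. *)
Fixpoint expr_width (e : expr) : nat :=
  match e with
  | Cst z => bitlen z
  | Reg _ => 1
  | Mem _ => 1
  | Bin _ e1 e2 => (expr_width e1 + expr_width e2 + 1)%N
  end.

Fixpoint expr_cost (e : expr) : nat :=
  (expr_width e +
   match e with
   | Cst _ => 0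
   | Reg x => bitlen x%:Z
   | Mem a => expr_cost a
   | Bin _ e1 e2 => expr_cost e1 + expr_cost e2
   end)%N.

Fixpoint prog_cost (p : prog) : nat :=
  match p with
  | Skip => 1
  | SetReg x e => (bitlen x%:Z + expr_cost e)%N
  | SetMem a e => (expr_cost a + expr_cost e)%N
  | Seq p q => (prog_cost p + prog_cost q)%N
  | If e p q => (expr_cost e + prog_cost p + prog_cost q)%N
  | While e p => (expr_cost e + prog_cost p)%N
  end.

Definition bounded (M : nat) (s : state) : Prop :=
  (forall x, `|regs s x| <= M)%N /\ (forall a, `|mem s a| <= M)%N.

Lemma bounded_set_reg M s x z :
  bounded M s -> (`|z| <= M)%N -> bounded M (set_reg s x z).
Proof. by move=> [hr hm] hz; split=> // y /=; case: ifP. Qed.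

Lemma bounded_set_mem M s a z :
  bounded M s -> (`|z| <= M)%N -> bounded M (set_mem s a z).
Proof. by move=> [hr hm] hz; split=> // b /=; case: ifP. Qed.

Lemma bitlen_eval M s e :
  bounded M s -> (bitlen (eval s e) <= expr_width e * bitlen M%:Z)%N.
Proof.
move=> [hr hm]; have M0 := bitlen_gt0 M%:Z.
elim: e => [z|x|a _|o e1 h1 e2 h2] /=.
- by rewrite leq_pmulr.
- by rewrite mul1n leq_bitlen.
- by rewrite mul1n leq_bitlen.
apply: leq_trans (bitlen_op _ _ _) _.
by rewrite !mulnDl mul1n !leq_add.
Qed.

Lemma eval_cost_le M s e :
  bounded M s -> (eval_cost s e <= expr_cost e * bitlen M%:Z)%N.
Proof.
move=> hs; have M0 := bitlen_gt0 M%:Z.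
elim: e => [z|x|a h|o e1 h1 e2 h2].
- by rewrite /= !addn0 leq_pmulr.
- rewrite [expr_cost _]/= [eval_cost _ _]/= mulnDl.
  apply: leq_add; last exact: leq_pmulr.
  by rewrite -/(eval s (Reg x)); apply: bitlen_eval.
- rewrite [expr_cost _]/= [eval_cost _ _]/= mulnDl leq_add //.
  by rewrite -/(eval s (Mem a)); apply: bitlen_eval.
- rewrite [expr_cost _]/= [eval_cost _ _]/= mulnDl leq_add //.
    exact: (bitlen_eval (Bin o e1 e2)).
  by rewrite mulnDl leq_add.
Qed.

(** Every assignment and every test counts as one step here; in exchange, [M] has to bound the whole
    store whenever an expression is evaluated. *)
Inductive uexec (M : nat) : prog -> state -> nat -> state -> Prop :=
  | uexec_Skip s : uexec M Skip s 1%N s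
  | uexec_SetReg s x e : bounded M s ->
      uexec M (SetReg x e) s 1%N (set_reg s x (eval s e))
  | uexec_SetMem s a e : bounded M s ->
      uexec M (SetMem a e) s 1%N (set_mem s (eval s a) (eval s e))
  | uexec_Seq p q s k1 s1 k2 s2 :
      uexec M p s k1 s1 -> uexec M q s1 k2 s2 ->
      uexec M (Seq p q) s (k1 + k2)%N s2
  | uexec_IfT e p q s k s' : bounded M s ->
      0 < eval s e -> uexec M p s k s' -> uexec M (If e p q) s k.+1 s'
  | uexec_IfF e p q s k s' : bounded M s ->
      eval s e <= 0 -> uexec M q s k s' -> uexec M (If e p q) s k.+1 s'
  | uexec_WhileT e p s k1 s1 k2 s2 : bounded M s ->
      0 < eval s e -> uexec M p s k1 s1 -> uexec M (While e p) s1 k2 s2 ->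
      uexec M (While e p) s (k1 + k2).+1 s2
  | uexec_WhileF e p s : bounded M s ->
      eval s e <= 0 -> uexec M (While e p) s 1%N s.

(** Each step executes an instruction or test occurring in the text of [p], so the sum [prog_cost p]
    over that text bounds any single one, up to the factor [bitlen M]. *)
Lemma exec_of_uexec M p s k s' : uexec M p s k s' ->
  exists2 t, exec p s t s' & (t <= k * (prog_cost p * bitlen M%:Z))%N.
Proof.
have M0 := bitlen_gt0 M%:Z.
elim=> {p s k s'} [s|s x e hs|s a e hs|p q s k1 s1 k2 s2 _ [t1 h1 b1] _ [t2 h2 b2]
  |e p q s k s' hs he _ [t h b]|e p q s k s' hs he _ [t h b]
  |e p s k1 s1 k2 s2 hs he _ [t1 h1 b1] _ [t2 h2 b2]|e p s hs he].
- by exists 1%N; [constructor | rewrite /= !mul1n].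
- exists (bitlen x%:Z + eval_cost s e)%N; first by constructor.
  rewrite mul1n mulnDl; apply: leq_add; first exact: leq_pmulr.
  exact: eval_cost_le.
- exists (eval_cost s a + eval_cost s e)%N; first by constructor.
  by rewrite mul1n mulnDl; apply: leq_add; apply: eval_cost_le.
- exists (t1 + t2)%N; first exact: exec_Seq h1 h2.
  apply: leq_trans (leq_add b1 b2) _; rewrite /=; nia.
- exists (eval_cost s e + t)%N; first exact: exec_IfT.
  have := eval_cost_le e hs; rewrite /=; nia.
- exists (eval_cost s e + t)%N; first exact: exec_IfF.
  have := eval_cost_le e hs; rewrite /=; nia.
- exists (eval_cost s e + t1 + t2)%N; first exact: exec_WhileT h2.
  have := eval_cost_le e hs; move: b2; rewrite /=; nia.
- exists (eval_cost s e); first exact: exec_WhileF.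
  by have := eval_cost_le e hs; rewrite /=; nia.
Qed.

(** Total correctness with a step budget. The postcondition may itself be a [runs], which is how
    sequences and loop iterations are chained. *)
Definition runs M p s (k : nat) (P : state -> Prop) : Prop :=
  exists k' s', [/\ uexec M p s k' s', (k' <= k)%N & P s'].

Lemma runs_weaken M p s k k' (P P' : state -> Prop) :
  (k <= k')%N -> (forall s', P s' -> P' s') -> runs M p s k P -> runs M p s k' P'.
Proof.
move=> kk' PP' [k0 [s' [h hk hP]]].
by exists k0, s'; split; [|apply: leq_trans kk'|apply: PP'].
Qed.

Lemma runs_le M p s k k' P : (k <= k')%N -> runs M p s k P -> runs M p s k' P.
Proof. by move=> kk'; apply: runs_weaken. Qed.

Lemma runs_Skip M s (P : state -> Prop) : P s -> runs M Skip s 1 P.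
Proof. by exists 1%N, s; split=> //; constructor. Qed.

Lemma runs_SetReg M s x e (P : state -> Prop) : bounded M s ->
  (`|eval s e| <= M)%N ->
  (bounded M (set_reg s x (eval s e)) -> P (set_reg s x (eval s e))) ->
  runs M (SetReg x e) s 1 P.
Proof.
move=> hs he hP; exists 1%N, (set_reg s x (eval s e)).
by split; [constructor | | apply: hP; apply: bounded_set_reg].
Qed.

Lemma runs_SetMem M s a e (P : state -> Prop) : bounded M s ->
  (`|eval s e| <= M)%N ->
  (bounded M (set_mem s (eval s a) (eval s e)) ->
   P (set_mem s (eval s a) (eval s e))) ->
  runs M (SetMem a e) s 1 P.
Proof.
move=> hs he hP; exists 1%N, (set_mem s (eval s a) (eval s e)).
by split; [constructor | | apply: hP; apply: bounded_set_mem].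
Qed.

Lemma runs_Seq M p q s k1 k2 P :
  runs M p s k1 (fun s1 => runs M q s1 k2 P) -> runs M (Seq p q) s (k1 + k2) P.
Proof.
move=> [a [s1 [h1 ha [b [s2 [h2 hb hP]]]]]].
by exists (a + b)%N, s2; split; [apply: uexec_Seq h1 h2 | apply: leq_add |].
Qed.

Lemma runs_If M e p q s k P : bounded M s ->
  (0 < eval s e -> runs M p s k P) -> (eval s e <= 0 -> runs M q s k P) ->
  runs M (If e p q) s k.+1 P.
Proof.
move=> hs hp hq; case: (ltP 0 (eval s e)) => he.
  by have [a [s1 [h ha hP]]] := hp he; exists a.+1, s1; split=> //; apply: uexec_IfT.
by have [a [s1 [h ha hP]]] := hq he; exists a.+1, s1; split=> //; apply: uexec_IfF.
Qed.

Lemma runs_WhileT M e p s k1 k2 P : bounded M s -> 0 < eval s e ->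
  runs M p s k1 (fun s1 => runs M (While e p) s1 k2 P) ->
  runs M (While e p) s (k1 + k2).+1 P.
Proof.
move=> hs he [a [s1 [h1 ha [b [s2 [h2 hb hP]]]]]].
exists (a + b).+1, s2; split=> //; first exact: uexec_WhileT h2.
by rewrite ltnS leq_add.
Qed.

Lemma runs_WhileF M e p s P : bounded M s -> eval s e <= 0 -> P s ->
  runs M (While e p) s 1 P.
Proof. by move=> hs he hP; exists 1%N, s; split=> //; apply: uexec_WhileF. Qed.

Lemma runs_While M e p (I : nat -> state -> Prop) N k s :
  (forall j s, (j <= N)%N -> I j s -> bounded M s) ->
  (forall j s, (j < N)%N -> I j s -> 0 < eval s e /\ runs M p s k (I j.+1)) ->
  (forall s, I N s -> eval s e <= 0) ->
  I 0%N s -> runs M (While e p) s (N * k.+1).+1 (I N).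
Proof.
move=> hb hstep hend.
suff H r j s1 : (j + r = N)%N -> I j s1 ->
    runs M (While e p) s1 (r * k.+1).+1 (I N).
  by move=> hI; apply: H hI.
elim: r j s1 => [|r IH] j s1 hj hI.
  rewrite addn0 in hj; subst j; rewrite mul0n.
  by apply: runs_WhileF (hI) => //; [apply: hb hI | apply: hend].
have jN : (j < N)%N by lia.
have [he hp] := hstep _ _ jN hI.
rewrite mulSn addSn; apply: (runs_le (k := (k + (r * k.+1).+1).+1)); first by lia.
apply: runs_WhileT he _; first exact: hb (ltnW jN) hI.
by apply: runs_weaken hp => // s2; apply: IH; lia.
Qed.

(** * Stripping leaves *)

(** An order for stripping leaves: when its turn comes, a vertex has no child left, while its parent
    is still present. *)
Fixpoint leaf_order (T : corner_tree) (vs : seq (ct_vertex T)) : bool :=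
  if vs is v :: vs' then
    [&& v != ct_root T, v \notin vs', ct_parent v \in ct_root T :: vs',
        all (fun u => ct_parent u != v) vs' & leaf_order vs']
  else true.

Lemma iter_fixed (V : Type) (g : V -> V) x k : g x = x -> iter k g x = x.
Proof. by move=> gx; elim: k => //= k ->. Qed.

Lemma ct_parent_neq (T : corner_tree) (v : ct_vertex T) :
  v != ct_root T -> ct_parent v != v.
Proof.
apply: contra => /eqP pv; have [k] := ct_rooted v.
by rewrite iter_fixed // => ->.
Qed.

Definition depth (T : corner_tree) (v : ct_vertex T) : nat :=
  ex_minn (P := fun k => iter k (@ct_parent T) v == ct_root T)
    (let: ex_intro k e := ct_rooted v in ex_intro _ k (introT eqP e)).

Lemma depth_parent (T : corner_tree) (v : ct_vertex T) :
  v != ct_root T -> (depth (ct_parent v) < depth v)%N.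
Proof.
move=> hv; rewrite /depth; case: ex_minnP => a _ hmin; case: ex_minnP => b.
case: b => [|b]; first by rewrite /= (negbTE hv).
by rewrite iterSr => /hmin.
Qed.

(** A vertex of maximal depth in [A] is nobody's parent within [A], since children are strictly
    deeper. It goes first, and the rest is still closed under parents up to the root. *)
Lemma leaf_order_exists_set (T : corner_tree) (A : {set ct_vertex T}) :
  ct_root T \notin A ->
  (forall u, u \in A -> ct_parent u \in ct_root T |: A) ->
  exists2 vs, leaf_order vs & vs =i A.
Proof.
elim: {A}#|A| {-2}A (erefl #|A|) => [|m IH] A hA rA clA.
  exists [::] => // u; move/eqP: hA; rewrite cards_eq0 => /eqP ->.
  by rewrite in_set0.
have /card_gt0P [v0 hv0] : (0 < #|A|)%N by rewrite hA.
case: (@arg_maxnP _ v0 (fun u => u \in A) (@depth T) hv0) => v hv hmax.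
have root_neq u : u \in A -> u != ct_root T.
  by move=> hu; apply: contraNneq rA => <-.
have par_neq u : u \in A -> ct_parent u != v.
  move=> hu; apply: contraTneq (depth_parent (root_neq _ hu)) => ->.
  by rewrite -leqNgt; apply: hmax.
have [|||vs ho hvs] := IH (A :\ v).
- by have := cardsD1 v A; rewrite hv hA => -[].
- by rewrite in_setD1 (negbTE rA) andbF.
- move=> u; rewrite in_setD1 => /andP[_ hu].
  by have := clA _ hu; rewrite !inE par_neq.
exists (v :: vs).
  rewrite /= root_neq // hvs setD11 ho andbT /=; apply/andP; split.
    by have := clA _ hv; rewrite !inE hvs !inE par_neq.
  by apply/allP=> u; rewrite hvs in_setD1 => /andP[_]; apply: par_neq.
by move=> u; rewrite inE hvs in_setD1; case: eqVneq => [->|] //=.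
Qed.

Lemma leaf_order_exists (T : corner_tree) : exists2 vs : seq (ct_vertex T),
  leaf_order vs & forall u, (u \in vs) = (u != ct_root T).
Proof.
have [||vs ho hvs] := @leaf_order_exists_set T [set~ ct_root T].
- by rewrite setC11.
- by move=> u _; rewrite !inE; case: eqP.
by exists vs => // u; rewrite hvs !inE.
Qed.

Lemma leq_sum_bool n (b : 'I_n -> bool) (x : 'I_n -> nat) B :
  (forall i, x i <= B)%N -> (\sum_i b i * x i <= n * B)%N.
Proof.
move=> xB; rewrite -[n in (n * B)%N]card_ord -sum_nat_const.
by apply: leq_sum => i _; case: (b i); rewrite ?mul1n ?mul0n.
Qed.

Section LeafRemoval.

Variables (T : corner_tree) (n : nat) (pi : 'S_n).

Local Notation V := (ct_vertex T).

Definition corner_sum (d : corner) (x : 'I_n -> nat) (i : 'I_n) : nat :=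
  (\sum_j in_corner pi d j i * x j)%N.

Lemma corner_sum_le d x B i : (forall j, x j <= B)%N -> (corner_sum d x i <= n * B)%N.
Proof. exact: leq_sum_bool. Qed.

Definition fold_leaf (X : V -> 'I_n -> nat) (v : V) : V -> 'I_n -> nat :=
  fun u i => if u == ct_parent v then
    (X u i * (if ct_label v is Some d then corner_sum d (X v) i else 1))%N
  else X u i.

Definition edge_ok (f : {ffun V -> 'I_n}) (u : V) : bool :=
  if ct_label u is Some d then in_corner pi d (f u) (f (ct_parent u)) else true.

Definition supported (i0 : 'I_n) (A : {set V}) : pred {ffun V -> 'I_n} :=
  fun f => [forall u, (u \notin A) ==> (f u == i0)].

(* The weighted number of occurrences of the part of [T] spanned by [A];
   vertices outside [A] are parked at [i0], so that each partial occurrence is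
   counted once. *)
Definition weight (i0 : 'I_n) (A : {set V}) (X : V -> 'I_n -> nat) : nat :=
  (\sum_(f | supported i0 A f) \prod_(u in A) (X u (f u) * edge_ok f u))%N.

Definition ffun_set (f : {ffun V -> 'I_n}) (v : V) (j : 'I_n) : {ffun V -> 'I_n} :=
  [ffun u => if u == v then j else f u].

(** A map supported on [A] splits uniquely into its value at [v] and the map in which [v] is parked
    at [i0]. *)
Lemma sum_supported i0 (A : {set V}) v (H : {ffun V -> 'I_n} -> nat) : v \in A ->
  (\sum_(f | supported i0 A f) H f =
   \sum_(f | supported i0 (A :\ v) f) \sum_j H (ffun_set f v j))%N.
Proof.
move=> hv; rewrite pair_big /=.
rewrite (reindex_onto (fun q => ffun_set q.1 v q.2)
  (fun f => (ffun_set f v i0, f v))) /=; last first.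
  by move=> f _; apply/ffunP=> u; rewrite !ffunE; case: eqP => // ->.
apply: eq_bigl => -[f j] /=; rewrite andbT; apply/andP/forallP.
  move=> [/forallP hs /eqP [hf _]] u; apply/implyP; rewrite in_setD1 negb_and negbK.
  case/orP=> [/eqP ->|hu]; first by rewrite -hf !ffunE eqxx.
  have := hs u; rewrite hu !ffunE /=; case: (eqVneq u v) => // uv.
  by rewrite uv hv in hu.
move=> hs; split.
  apply/forallP=> u; apply/implyP=> hu; rewrite ffunE.
  case: (eqVneq u v) => [uv|_]; first by rewrite uv hv in hu.
  by have := hs u; rewrite in_setD1 (negbTE hu) andbF.
apply/eqP; congr pair; last by rewrite ffunE eqxx.
apply/ffunP=> u; rewrite !ffunE; case: eqP => // ->.
by have := hs v; rewrite setD11 => /eqP.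
Qed.

(** As [v] is a leaf within [A], its image occurs only in its own factor. Summing over that image
    gives a [corner_sum] at the image of the parent, which the parent's weight absorbs. *)
Lemma weight_fold i0 (A : {set V}) X v : v \in A -> v != ct_root T ->
  ct_parent v \in A -> {in A, forall u, ct_parent u != v} ->
  weight i0 A X = weight i0 (A :\ v) (fold_leaf X v).
Proof.
move=> hv vr hp hc; rewrite /weight (sum_supported _ _ hv).
apply: eq_bigr => f _.
case hd: (ct_label v) => [d|]; last by move/ct_label_root/eqP: hd; rewrite (negbTE vr).
have pv := ct_parent_neq vr.
have hpA : ct_parent v \in A :\ v by rewrite in_setD1 pv.
have split_j j : (\prod_(u in A) (X u (ffun_set f v j u) * edge_ok (ffun_set f v j) u) =
    in_corner pi d j (f (ct_parent v)) * X v j *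
    \prod_(u in A :\ v) (X u (f u) * edge_ok f u))%N.
  rewrite (big_setD1 v hv) /=; congr (_ * _)%N.
    by rewrite /edge_ok hd !ffunE eqxx (negbTE pv) mulnC.
  apply: eq_bigr => u; rewrite in_setD1 => /andP[uv uA].
  rewrite /edge_ok !ffunE (negbTE uv); case: (ct_label u) => // d'.
  by rewrite (negbTE (hc _ uA)).
under eq_bigr do rewrite split_j.
rewrite -big_distrl /= (big_setD1 _ hpA) [RHS](big_setD1 _ hpA) /=.
rewrite {1}/fold_leaf eqxx hd !mulnA; congr (_ * _ * _)%N.
  by rewrite mulnC.
apply: eq_bigr => u; rewrite in_setD1 => /andP[uv _].
by rewrite /fold_leaf (negbTE uv).
Qed.

Lemma weight_root i0 X : weight i0 [set ct_root T] X = (\sum_i X (ct_root T) i)%N.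
Proof.
rewrite /weight (sum_supported _ _ (set11 _)).
rewrite (big_pred1 [ffun=> i0]); last first.
  move=> f; apply/forallP/eqP => [h|-> u]; last by rewrite ffunE eqxx implybT.
  by apply/ffunP=> u; have := h u; rewrite setDv in_set0 ffunE => /eqP.
apply: eq_bigr => j _; rewrite big_set1 /edge_ok (ct_label_root _).2 // muln1.
by rewrite ffunE eqxx.
Qed.

Lemma weight_foldl i0 vs X : leaf_order vs ->
  weight i0 [set u in ct_root T :: vs] X =
  (\sum_i foldl fold_leaf X vs (ct_root T) i)%N.
Proof.
elim: vs X => [|v vs IH] X /=.
  by move=> _; rewrite -(weight_root i0); congr weight; apply/setP=> u; rewrite !inE.
case/and5P=> vr vvs pv /allP hc ho.
rewrite -IH // (@weight_fold i0 _ _ v).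
- congr weight; apply/setP=> u; rewrite !inE.
  case: (eqVneq u v) => [->|//]; by rewrite (negbTE vr) (negbTE vvs).
- by rewrite !inE eqxx orbT.
- exact: vr.
- by move: pv; rewrite !inE => /orP[->//|->]; rewrite !orbT.
move=> u; rewrite !inE => /or3P[/eqP->|/eqP->|/hc //].
  by rewrite ct_parent_root eq_sym.
exact: ct_parent_neq.
Qed.

Lemma occurrences_weight i0 : occurrences T pi = weight i0 setT (fun _ _ => 1%N).
Proof.
rewrite /occurrences -sum1dep_card /weight big_mkcond [RHS]big_mkcond /=.
apply: eq_bigr => f _; have -> : supported i0 setT f.
  by apply/forallP=> u; rewrite in_setT.
under eq_bigr do rewrite mul1n.
rewrite /is_occurrence; case: forallP => [h|h].
  by rewrite big1 // => u _; rewrite /edge_ok; have := h u; case: ct_label => // d ->.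
have /existsP [u hu] : [exists u, ~~ edge_ok f u].
  by rewrite -negb_forall; apply/forallP.
by rewrite (bigD1 u) //= (negbTE hu).
Qed.

Lemma occurrences_foldl vs : leaf_order vs -> (forall u, (u \in vs) = (u != ct_root T)) ->
  occurrences T pi = (\sum_i foldl fold_leaf (fun _ _ => 1%N) vs (ct_root T) i)%N.
Proof.
(* For [n = 0] there is no position to park vertices at; both sides vanish, because the root has no
   possible image. *)
move=> ho hvs; have [n0|/card_gt0P [i0 _]] := posnP #|'I_n|.
  rewrite big_pred0; last by move=> i; have := card0_eq n0 i.
  apply/eqP; rewrite cards_eq0; apply/eqP/setP=> f.
  by have := card0_eq n0 (f (ct_root T)); rewrite inE.
rewrite (occurrences_weight i0) -(weight_foldl i0) //; congr weight.
by apply/setP=> u; rewrite !inE hvs orbN.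
Qed.

End LeafRemoval.

(** * Segment trees *)

(* Nodes are numbered as in a binary heap: leaf [w] of the tree with [2 ^ L]
   leaves is node [2 ^ L + w], and the parent of node [q] is [q./2]. *)
Fixpoint prefix_query (L : nat) (c : nat -> nat) (q : nat) : nat :=
  if L is L'.+1 then ((if odd q then c q.-1 else 0) + prefix_query L' c q./2)%N
  else 0.

(** The effect on node [p] of inserting a unit at leaf [q]. It is a number rather than a boolean so
    that tree contents are linear combinations of such functions. *)
Fixpoint is_ancestor (L q p : nat) : nat :=
  ((p == q) + (if L is L'.+1 then is_ancestor L' q./2 p else 0))%N.

Lemma eq_prefix_query L c c' q : (2 ^ L <= q < 2 ^ L.+1)%N ->
  (forall p, (0 < p < 2 ^ L.+1)%N -> c p = c' p) ->
  prefix_query L c q = prefix_query L c' q.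
Proof.
elim: L q => //= L IH q hq hc; congr (_ + _)%N.
  by case: ifP => // oq; apply: hc; move: hq (expn_gt0 2 L); rewrite !expnS; lia.
apply: IH => [|p hp]; first by move: hq; rewrite !expnS; lia.
by apply: hc; move: hp; rewrite !expnS; lia.
Qed.

(** Linearity of queries in the contents of the tree reduces their correctness to a single inserted
    unit. *)
Lemma prefix_query_sum (I : finType) L (F : I -> nat) (c : I -> nat -> nat) q :
  prefix_query L (fun p => \sum_i F i * c i p)%N q =
  (\sum_i F i * prefix_query L (c i) q)%N.
Proof.
elim: L q => [|L IH] q /=; first by rewrite big1 // => i _; rewrite muln0.
rewrite IH; case: ifP => _.
  by rewrite -big_split; apply: eq_bigr => i _; rewrite mulnDr.
by rewrite add0n; apply: eq_bigr => i _; rewrite add0n.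
Qed.

Lemma is_ancestor_leaf L q p : (2 ^ L <= q < 2 ^ L.+1)%N -> (2 ^ L <= p)%N ->
  is_ancestor L q p = (p == q).
Proof.
suff H l r x : (r < 2 ^ l.+1)%N -> (2 ^ l.+1 <= x)%N -> is_ancestor l r x = 0%N.
  case: L => [|L] /=; first by rewrite addn0.
  by move=> hq hp; rewrite H ?addn0 //; move: hq; rewrite !expnS; lia.
elim: l r => [|l IH] r hr hx /=; first by move: hr hx; case: eqP; lia.
rewrite IH; [|by move: hr; rewrite !expnS; lia|by move: hx; rewrite !expnS; lia].
by case: eqP hr hx => //; lia.
Qed.

Lemma is_ancestor_le1 L q p : (2 ^ L <= q < 2 ^ L.+1)%N -> (is_ancestor L q p <= 1)%N.
Proof.
elim: L q => [|L IH] q hq /=; first by case: eqP.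
case: eqP => [->|_] /=; last by apply: IH; move: hq; rewrite !expnS; lia.
suff -> : is_ancestor L q./2 q = 0%N by [].
have hL : (0 < 2 ^ L)%N by rewrite expn_gt0.
by rewrite is_ancestor_leaf; move: hq; rewrite !expnS; lia.
Qed.

(** At a right child the query adds the left sibling. Accordingly [q' < q] means that either the
    parents are already in this order, or [q] is odd and [q'] is its left sibling. *)
Lemma prefix_query_ancestor L q q' :
  (2 ^ L <= q < 2 ^ L.+1)%N -> (2 ^ L <= q' < 2 ^ L.+1)%N ->
  prefix_query L (is_ancestor L q') q = (q' < q)%N.
Proof.
elim: L q q' => [|L IH] q q' hq hq'; first by move: hq hq' => /=; lia.
rewrite [LHS]/=.
have -> : prefix_query L (fun p => (p == q') + is_ancestor L q'./2 p)%N q./2 =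
    (q'./2 < q./2)%N.
  rewrite -IH; try by move: hq hq'; rewrite !expnS; lia.
  apply: eq_prefix_query => [|p hp]; first by move: hq; rewrite !expnS; lia.
  by case: eqP => // pq; move: hp hq'; rewrite pq; lia.
case: ifP => oq; last by move: hq hq'; rewrite !expnS; lia.
rewrite -[(_ + _)%N in X in (X + _)%N]/(is_ancestor L.+1 q' q.-1).
rewrite is_ancestor_leaf //; last by move: hq; rewrite !expnS; lia.
by move: hq hq'; rewrite !expnS; case: eqP; lia.
Qed.

(** Nodes are numbered from 1 to [2 * m - 1], so each tree gets a block of [2 * m] cells; array
    blocks of [n] cells follow the input. Every sweep takes a new tree, which saves clearing old
    ones. *)
Definition seg_addr (m g p : nat) : int := - (2 * g * m + p)%:Z.
Definition arr_addr (n k i : nat) : int := (k.+1 * n + i.+1)%:Z.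

Definition seg_expr (g : nat) (e : expr) : expr :=
  Bin Sub (Cst 0) (Bin Add (Bin Mul (Cst (2 * g)%:Z) (Reg 2)) e).
Definition arr_expr (k : nat) (e : expr) : expr :=
  Bin Add (Bin Mul (Cst k.+1%:Z) (Reg 0)) e.

Lemma eval_seg_expr s m g e p : regs s 2 = m%:Z -> eval s e = p%:Z ->
  eval s (seg_expr g e) = seg_addr m g p.
Proof. by move=> /= -> ->; rewrite /seg_addr; lia. Qed.

Lemma eval_arr_expr s n k e (i : nat) : regs s 0 = n%:Z -> eval s e = i.+1%:Z ->
  eval s (arr_expr k e) = arr_addr n k i.
Proof. by move=> /= -> ->; rewrite /arr_addr; lia. Qed.

Lemma arr_addr_inj n k k' (i i' : 'I_n) :
  arr_addr n k i = arr_addr n k' i' -> k = k' /\ i = i'.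
Proof.
move=> [] h; have [hi hi'] := (ltn_ord i, ltn_ord i').
have h' : (k * n + i = k' * n + i')%N by lia.
have n0 : (0 < n)%N by lia.
have kk : k = k'.
  by move: (congr1 (divn^~ n) h'); rewrite /= !divnMDl // !divn_small // !addn0.
by split=> //; apply: val_inj => /=; move: h'; rewrite kk => /addnI.
Qed.

Lemma arr_seg_addr n m k g p i : arr_addr n k i != seg_addr m g p.
Proof. by apply/eqP; rewrite /arr_addr /seg_addr; lia. Qed.

Lemma seg_addr_inj m g g' p p' : (0 < p < 2 * m)%N -> (0 < p' < 2 * m)%N ->
  seg_addr m g p = seg_addr m g' p' -> g = g' /\ p = p'.
Proof.
rewrite /seg_addr => /andP[p0 hp] /andP[p'0 hp'] h.
have h' : (g * (2 * m) + p = g' * (2 * m) + p')%N by lia.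
have m0 : (0 < 2 * m)%N by lia.
have gg : g = g'.
  by move: (congr1 (divn^~ (2 * m)%N) h'); rewrite /= !divnMDl // !divn_small // !addn0.
by split=> //; move: h'; rewrite gg => /addnI.
Qed.

(** Register 4 climbs from a leaf to the root and register 5 collects the sum. The inner test is the
    parity of the node, expressed through division. *)
Definition query_loop (g : nat) : prog :=
  While (Bin Sub (Reg 4) (Cst 1))
    (Seq (If (Bin Sub (Reg 4) (Bin Mul (Cst 2) (Bin Div (Reg 4) (Cst 2))))
             (SetReg 5 (Bin Add (Reg 5) (Mem (seg_expr g (Bin Sub (Reg 4) (Cst 1))))))
             Skip)
         (SetReg 4 (Bin Div (Reg 4) (Cst 2)))).

Lemma divz2 (q : nat) : (q%:Z %/ 2)%Z = q./2%:Z.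
Proof. by rewrite divz_nat divn2. Qed.

Lemma query_loopP M g m L c s (q a : nat) : bounded M s ->
  regs s 2 = m%:Z -> regs s 4 = q%:Z -> regs s 5 = a%:Z ->
  (2 ^ L <= q < 2 ^ L.+1)%N ->
  (forall p, (0 < p < 2 ^ L.+1)%N -> mem s (seg_addr m g p) = (c p)%:Z) ->
  (a + prefix_query L c q <= M)%N ->
  runs M (query_loop g) s (4 * L).+1 (fun s' => [/\ bounded M s', mem s' = mem s,
    forall x, x != 4%N -> x != 5%N -> regs s' x = regs s x &
    regs s' 5 = (a + prefix_query L c q)%:Z]).
Proof.
elim: L s q a => [|L IH] s q a hs h2 h4 h5 hq hc hM.
  apply: runs_WhileF => //=; first by move: hq; rewrite h4; lia.
  by rewrite addn0; split.
have qM : (q <= M)%N by have := hs.1 4%N; rewrite h4.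
have hL : (0 < 2 ^ L)%N by rewrite expn_gt0.
have -> : (4 * L.+1).+1 = ((1 + 1).+1 - 1 + 1 + (4 * L).+1).+1 by lia.
apply: runs_WhileT => //; first by move: hq; rewrite /= h4 !expnS; lia.
pose a' := (a + (if odd q then c q.-1 else 0))%N.
have ha' : (a' + prefix_query L c q./2 <= M)%N by move: hM; rewrite /= /a'; lia.
apply: runs_Seq; rewrite subn1 /=.
(* The continuation shared by both branches of the parity test, with [a'] as the new partial sum. *)
have next s1 : bounded M s1 -> mem s1 = mem s -> regs s1 5 = a'%:Z ->
   (forall x, x != 5%N -> regs s1 x = regs s x) ->
   runs M (SetReg 4 (Bin Div (Reg 4) (Cst 2))) s1 1 (fun s2 =>
     runs M (query_loop g) s2 (4 * L).+1 (fun s' => [/\ bounded M s', mem s' = mem s,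
    forall x, x != 4%N -> x != 5%N -> regs s' x = regs s x &
    regs s' 5 = (a + prefix_query L.+1 c q)%:Z])).
  move=> hs1 hm1 h51 hr1.
  have e4 : eval s1 (Bin Div (Reg 4) (Cst 2)) = q./2%:Z by rewrite /= hr1 // h4 divz2.
  apply: runs_SetReg => //; rewrite e4; first by lia.
  move=> hs2; apply: runs_weaken (IH _ q./2 a' hs2 _ _ _ _ _ _) => //=.
  - move=> s' [b1 b2 b3 b4]; split=> //; first by rewrite b2.
      by move=> x x4 x5; rewrite b3 //= (negbTE x4) hr1.
    by rewrite b4 /a' addnA.
  - by rewrite hr1.
  - by move: hq; rewrite !expnS; lia.
  - by move=> p hp; rewrite hm1; apply: hc; move: hp; rewrite !expnS; lia.
apply: runs_If => //.
  rewrite /= h4 divz2 => oq.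
  have {}oq : odd q by lia.
  have cell : eval s (Mem (seg_expr g (Bin Sub (Reg 4) (Cst 1)))) = (c q.-1)%:Z.
    have e1 : eval s (Bin Sub (Reg 4) (Cst 1)) = q.-1%:Z.
      by rewrite /= h4; move: hq; rewrite !expnS; lia.
    rewrite -hc; last by move: hq; rewrite !expnS; lia.
    by rewrite -(eval_seg_expr g h2 e1).
  have e5 : eval s (Bin Add (Reg 5) (Mem (seg_expr g (Bin Sub (Reg 4) (Cst 1))))) = a'%:Z.
    by rewrite -[LHS]/(regs s 5 + eval s (Mem (seg_expr g (Bin Sub (Reg 4) (Cst 1)))))
       cell h5 /a' oq.
  apply: runs_SetReg => //; rewrite e5; first by lia.
  by move=> hs1; apply: next => // x x5 /=; rewrite (negbTE x5).
rewrite /= h4 divz2 => oq.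
have {}oq : odd q = false by lia.
by apply: runs_Skip; apply: next => //; rewrite /a' oq addn0.
Qed.

Definition update_loop (g : nat) : prog :=
  While (Reg 4)
    (Seq (SetMem (seg_expr g (Reg 4)) (Bin Add (Mem (seg_expr g (Reg 4))) (Reg 7)))
         (SetReg 4 (Bin Div (Reg 4) (Cst 2)))).

(** The first write is on the bottom level, and the remaining ones only touch nodes of smaller
    number, for which [c] is still accurate. Unlike the query, the loop also visits the root, hence
    [L.+1] rounds of three steps. *)
Lemma update_loopP M g m L c s (q x : nat) : bounded M s ->
  regs s 2 = m%:Z -> regs s 4 = q%:Z -> regs s 7 = x%:Z ->
  (2 ^ L <= q < 2 ^ L.+1)%N ->
  (forall p, (0 < p < 2 ^ L.+1)%N -> mem s (seg_addr m g p) = (c p)%:Z) ->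
  (forall p, (0 < p < 2 ^ L.+1)%N -> c p + x <= M)%N ->
  runs M (update_loop g) s (3 * L.+1).+1 (fun s' => [/\ bounded M s',
    forall y, y != 4%N -> regs s' y = regs s y,
    forall a, (forall p, (0 < p < 2 ^ L.+1)%N -> a <> seg_addr m g p) ->
      mem s' a = mem s a &
    forall p, (0 < p < 2 ^ L.+1)%N ->
      mem s' (seg_addr m g p) = (c p + is_ancestor L q p * x)%:Z]).
Proof.
elim: L s q c => [|L IH] s q c hs h2 h4 h7 hq hc hM;
  have qM : (q <= M)%N by have := hs.1 4%N; rewrite h4.
  have eq4 : eval s (Reg 4) = 1%N%:Z by rewrite /= h4; lia.
  have q1 : q = 1%N by lia.
  subst q; have -> : (3 * 1).+1 = (1 + 1 + 1).+1 by [].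
  apply: runs_WhileT => //; first by rewrite /= h4.
  have ev : eval s (Bin Add (Mem (seg_expr g (Reg 4))) (Reg 7)) = (c 1%N + x)%:Z.
    rewrite -[LHS]/(mem s (eval s (seg_expr g (Reg 4))) + regs s 7).
    by rewrite (eval_seg_expr g h2 eq4) hc // h7.
  apply: runs_Seq; apply: runs_SetMem => //; rewrite ?(eval_seg_expr g h2 eq4) ev.
    exact: hM.
  move=> hs1; apply: runs_SetReg => //=; first by rewrite h4.
  rewrite h4 => hs2; apply: runs_WhileF => //=; split=> //= [y y4|a ha|p hp].
  - by rewrite (negbTE y4).
  - by case: eqP => // ea; case: (ha 1%N).
  have -> : p = 1%N by lia.
  by rewrite eqxx addn0 mul1n.
have hL : (0 < 2 ^ L)%N by rewrite expn_gt0.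
have hqr : (0 < q < 2 ^ L.+2)%N by move: hq; rewrite !expnS; lia.
have -> : (3 * L.+2).+1 = (1 + 1 + (3 * L.+1).+1).+1 by lia.
apply: runs_WhileT => //; first by rewrite /= h4; lia.
apply: runs_Seq.
have eq4 : eval s (Reg 4) = q%:Z by [].
have ev : eval s (Bin Add (Mem (seg_expr g (Reg 4))) (Reg 7)) = (c q + x)%:Z.
  rewrite -[LHS]/(mem s (eval s (seg_expr g (Reg 4))) + regs s 7).
  by rewrite (eval_seg_expr g h2 eq4) hc // h7.
apply: runs_SetMem => //; rewrite ?(eval_seg_expr g h2 eq4) ev; first exact: hM.
move=> hs1.
have e4 : eval (set_mem s (seg_addr m g q) (c q + x)%:Z) (Bin Div (Reg 4) (Cst 2)) = q./2%:Z.
  by rewrite /= h4 divz2.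
apply: runs_SetReg => //; rewrite e4; first by lia.
have pq p : (0 < p < 2 ^ L.+1)%N -> seg_addr m g p == seg_addr m g q = false.
  by move=> hp; apply/eqP; rewrite /seg_addr; move: hp hq; rewrite !expnS; lia.
move=> hs2; apply: runs_weaken (IH _ q./2 c hs2 _ _ _ _ _ _) => //=.
- move=> s' [b1 b2 b3 b4]; split=> //.
  + by move=> y y4; rewrite b2 // (negbTE y4).
  + move=> a ha; rewrite b3; first by case: eqP => // ea; case: (ha q).
    by move=> p hp; apply: ha; move: hp; rewrite !expnS; lia.
  move=> p hp; case: (ltnP p (2 ^ L.+1)) => hpL.
    have hp' : (0 < p < 2 ^ L.+1)%N by lia.
    rewrite b4 //; case: eqP => [pq'|//]; by have := pq _ hp'; rewrite pq' eqxx.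
  (* A node on the bottom level is out of reach of the later rounds, so only the first write can
     have changed it. *)
  rewrite b3; last by move=> p' hp' /(congr1 (@absz)); rewrite /seg_addr; lia.
  rewrite -[is_ancestor L q./2 p]add0n.
  have -> : ((p == q) + (0 + is_ancestor L q./2 p))%N = is_ancestor L.+1 q p by [].
  rewrite is_ancestor_leaf //.
  case: (eqVneq p q) => [->|npq]; first by rewrite eqxx mul1n.
  by rewrite mul0n addn0 hc //; case: eqP => // /(congr1 (@absz)); rewrite /seg_addr; lia.
- by move: hq; rewrite !expnS; lia.
- move=> p hp; rewrite pq // hc //; move: hp; rewrite !expnS; lia.
- by move=> p hp; apply: hM; move: hp; rewrite !expnS; lia.
Qed.

(** * Sweeping the plot *)

Definition east (d : corner) : bool := if d is SE then true else if d is NE then true else false.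
Definition north (d : corner) : bool := if d is NW then true else if d is NE then true else false.

Definition pos_rank (d : corner) n (i : 'I_n) : nat := if east d then (n.-1 - i)%N else i.
Definition val_rank (d : corner) n (pi : 'S_n) (i : 'I_n) : nat :=
  if north d then (n.-1 - pi i)%N else pi i.

(* Reflecting positions and values reduces every corner to [SW]. *)
Lemma in_cornerE n (pi : 'S_n) d i j :
  in_corner pi d i j = (pos_rank d i < pos_rank d j)%N && (val_rank d pi i < val_rank d pi j)%N.
Proof.
have := ltn_ord i; have := ltn_ord j; have := ltn_ord (pi i); have := ltn_ord (pi j).
by rewrite /pos_rank /val_rank; case: d => /=; lia.
Qed.

Lemma pos_rank_inj d n : injective (@pos_rank d n).
Proof.
move=> i j h; apply: val_inj => /=; move: h (ltn_ord i) (ltn_ord j).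
by rewrite /pos_rank; case: ifP => _; lia.
Qed.

Lemma pos_rank_surj d n j : (j < n)%N -> exists i : 'I_n, pos_rank d i = j.
Proof.
move=> hj; case e: (east d); last by exists (Ordinal hj); rewrite /pos_rank e.
by exists (rev_ord (Ordinal hj)); rewrite /pos_rank e /=; lia.
Qed.

Lemma val_rank_lt d n (pi : 'S_n) i : (val_rank d pi i < n)%N.
Proof. by have := ltn_ord (pi i); rewrite /val_rank; case: ifP => _; lia. Qed.

(* Registers: 0 holds n, 1 the accumulated result, 2 the number m of leaves of a
   segment tree.  Cells 1..n hold the input; entry i of array k is stored, minus
   one, in cell [arr_addr n k i], so that untouched memory represents arrays of
   ones; segment tree g lives at the negative addresses [seg_addr m g p], and the
   trees numbered from [g] on are still empty. *)
Record layout n (pi : 'S_n) (m g : nat) (A : nat -> 'I_n -> nat) (acc : int)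
    (s : state) : Prop := Layout {
  lay_n : regs s 0 = n%:Z;
  lay_acc : regs s 1 = acc;
  lay_m : regs s 2 = m%:Z;
  lay_pi : forall i : 'I_n, mem s i.+1%:Z = (pi i).+1%:Z;
  lay_arr : forall k (i : 'I_n), mem s (arr_addr n k i) = (A k i)%:Z - 1;
  lay_seg : forall g' p, (g <= g')%N -> (0 < p < 2 * m)%N -> mem s (seg_addr m g' p) = 0
}.

Lemma layout_regs n (pi : 'S_n) m g A acc s s' :
  (forall x, (x < 3)%N -> regs s' x = regs s x) -> mem s' = mem s ->
  layout pi m g A acc s -> layout pi m g A acc s'.
Proof. by move=> hr hm []; split; rewrite ?hr ?hm. Qed.

Lemma layout_le n (pi : 'S_n) m g g' A acc s : (g <= g')%N ->
  layout pi m g A acc s -> layout pi m g' A acc s.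
Proof.
by move=> gg [h0 h1 h2 hpi ha hs]; split=> // g1 p h; apply: hs; apply: leq_trans h.
Qed.

(** The one-based position visited in round [Reg 3]. Eastern corners are swept from right to left,
    so that the relevant positions come before the one queried. *)
Definition pos_expr (d : corner) : expr :=
  if east d then Bin Sub (Reg 0) (Reg 3) else Bin Add (Reg 3) (Cst 1).

Definition leaf_expr (d : corner) : expr :=
  Bin Add (Reg 2) (if north d then Bin Sub (Reg 0) (Mem (Reg 6))
                   else Bin Sub (Mem (Reg 6)) (Cst 1)).

(** Array entries are stored minus one, whence the additions and subtractions of 1. Register 4 is
    loaded twice because the query destroys it. *)
Definition sweep_body (d : corner) (k l g : nat) : prog :=
  Seq (SetReg 6 (pos_expr d))
  (Seq (SetReg 4 (leaf_expr d))
  (Seq (SetReg 5 (Cst 0))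
  (Seq (query_loop g)
  (Seq (SetMem (arr_expr l (Reg 6))
         (Bin Sub (Bin Mul (Bin Add (Mem (arr_expr l (Reg 6))) (Cst 1)) (Reg 5)) (Cst 1)))
  (Seq (SetReg 4 (leaf_expr d))
  (Seq (SetReg 7 (Bin Add (Mem (arr_expr k (Reg 6))) (Cst 1)))
  (Seq (update_loop g)
       (SetReg 3 (Bin Add (Reg 3) (Cst 1)))))))))).

Definition sweep (d : corner) (k l g : nat) : prog :=
  Seq (SetReg 3 (Cst 0))
      (While (Bin Sub (Reg 0) (Reg 3)) (sweep_body d k l g)).

Definition sweep_array n (pi : 'S_n) (d : corner) (k l : nat)
    (A : nat -> 'I_n -> nat) : nat -> 'I_n -> nat :=
  fun k' i => if k' == l then (A l i * corner_sum pi d (A k) i)%N else A k' i.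

Section Sweep.

Variables (n : nat) (pi : 'S_n) (L M B : nat) (d : corner) (k l g : nat).
Variables (A : nat -> 'I_n -> nat) (acc : int).
Local Notation m := (2 ^ L)%N.
Hypotheses (n_le : (n <= m)%N) (mM : (2 * m <= M)%N) (B0 : (0 < B)%N)
  (BM : (n.+1 * B * B <= M)%N) (AB : forall k i, (A k i <= B)%N) (kl : k != l).

Let partial (j : nat) : nat -> 'I_n -> nat :=
  fun k' i => if (k' == l) && (pos_rank d i < j)%N
              then (A l i * corner_sum pi d (A k) i)%N else A k' i.

(** The tree after [j] rounds, written as a superposition of single insertions to suit
    [prefix_query_sum]. *)
Let tree (j p : nat) : nat :=
  (\sum_i (pos_rank d i < j) * A k i * is_ancestor L (m + val_rank d pi i) p)%N.

Let inv (j : nat) (s : state) : Prop :=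
  [/\ bounded M s, layout pi m g.+1 (partial j) acc s, regs s 3 = j%:Z &
      forall p, (0 < p < 2 * m)%N -> mem s (seg_addr m g p) = (tree j p)%:Z].

Lemma leaf_node i : (2 ^ L <= m + val_rank d pi i < 2 ^ L.+1)%N.
Proof. by have := val_rank_lt d pi i; rewrite expnS; lia. Qed.

Lemma tree_le j p : (tree j p <= n * B)%N.
Proof.
apply: leq_trans (leq_sum_bool (fun i => pos_rank d i < j)%N (AB k)).
apply: leq_sum => i _; rewrite -[leqRHS]muln1 leq_mul2l.
by rewrite is_ancestor_le1 ?orbT // leaf_node.
Qed.

Lemma treeS i p :
  tree (pos_rank d i).+1 p =
  (tree (pos_rank d i) p + is_ancestor L (m + val_rank d pi i) p * A k i)%N.
Proof.
rewrite /tree (bigD1 i) //= [in RHS](bigD1 i) //= ltnn ltnSn.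
rewrite !mul0n add0n mul1n addnC; congr (_ + _)%N; last exact: mulnC.
apply: eq_bigr => i' ne; congr (_ * _ * _)%N; congr (nat_of_bool _).
rewrite ltnS leq_eqVlt; case: eqP => // /pos_rank_inj h.
by rewrite h eqxx in ne.
Qed.

(** Being in the tree accounts for the order of positions, and the prefix query for that of values;
    by [in_cornerE] the two together are membership in the corner. *)
Lemma tree_query i :
  prefix_query L (tree (pos_rank d i)) (m + val_rank d pi i) = corner_sum pi d (A k) i.
Proof.
rewrite /tree prefix_query_sum; apply: eq_bigr => i' _.
rewrite prefix_query_ancestor ?leaf_node // ltn_add2l in_cornerE.
by case: (_ < _)%N; case: (_ < _)%N; rewrite ?muln0 ?muln1 ?mul1n.
Qed.

Lemma eval_leaf s (i : 'I_n) : regs s 0 = n%:Z -> regs s 2 = m%:Z -> regs s 6 = i.+1%:Z ->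
  mem s i.+1%:Z = (pi i).+1%:Z ->
  eval s (leaf_expr d) = (m + val_rank d pi i)%:Z.
Proof.
move=> h0 h2 h6 hm; have := ltn_ord (pi i); rewrite /leaf_expr /val_rank.
by case: ifP => _ /=; rewrite h2 ?h0 h6 hm; lia.
Qed.

Lemma partialS i : partial (pos_rank d i).+1 =2 fun k' i' =>
  if (k' == l) && (i' == i) then (A l i * corner_sum pi d (A k) i)%N
  else partial (pos_rank d i) k' i'.
Proof.
move=> k' i'; rewrite /partial; case: eqP => //= _.
case: (eqVneq i' i) => [->|ne]; first by rewrite ltnSn.
rewrite ltnS leq_eqVlt; case: eqP => // /pos_rank_inj h.
by rewrite h eqxx in ne.
Qed.

Lemma sweep_bodyP j s : (j < n)%N -> inv j s ->
  runs M (sweep_body d k l g) s (7 * L + 12) (inv j.+1).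
Proof.
move=> jn [hs lay h3 hseg].
have [i ij] := pos_rank_surj d jn; subst j.
have [h0 h1 h2 hpi harr hfree] := lay.
have hi := ltn_ord i.
have node := leaf_node i.
have nodeM : (m + val_rank d pi i <= M)%N by move: node; rewrite expnS; lia.
have csM : (corner_sum pi d (A k) i <= M)%N by have := corner_sum_le pi d i (AB k); nia.
(* One summand for each of the nine instructions of the body; the fourth is the query and the eighth
   the update. *)
rewrite (_ : (7 * L + 12)%N = (1 + (1 + (1 + ((4 * L).+1 +
  (1 + (1 + (1 + ((3 * L.+1).+1 + 1))))))))%N); last by lia.
have e6 : eval s (pos_expr d) = i.+1%:Z.
  rewrite /pos_expr; move: h3; rewrite /pos_rank.
  by case: ifP => _ /=; rewrite ?h0 => ->; lia.
apply: runs_Seq; apply: runs_SetReg => //; rewrite e6; first by lia.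
move=> hs1; set s1 := set_reg s 6 _ in hs1 *.
have e4 : eval s1 (leaf_expr d) = (m + val_rank d pi i)%:Z.
  exact: (@eval_leaf s1 i h0 h2 erefl (hpi i)).
apply: runs_Seq; apply: runs_SetReg => //; rewrite e4 //.
move=> hs2; set s2 := set_reg s1 4 _ in hs2 *.
apply: runs_Seq; apply: runs_SetReg => // hs3; set s3 := set_reg s2 5 _ in hs3 *.
apply: runs_Seq.
have Q := @query_loopP M g m L (tree (pos_rank d i)) s3 _ 0%N hs3 h2 erefl erefl node.
rewrite add0n tree_query in Q.
apply: runs_weaken (Q _ csM) => //; last first.
  by move=> p; rewrite expnS; apply: hseg.
move=> s4 [hs4 m4 r4 r45].
have r46 : regs s4 6 = i.+1%:Z by rewrite r4.
have {}r4 x : x != 4%N -> x != 5%N -> x != 6%N -> regs s4 x = regs s x.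
  by move=> x4 x5 x6; rewrite r4 //= (negbTE x5) (negbTE x4) (negbTE x6).
have {}m4 a : mem s4 a = mem s a by rewrite m4.
have el : eval s4 (arr_expr l (Reg 6)) = arr_addr n l i.
  by apply: eval_arr_expr => //; rewrite r4.
have part_i : partial (pos_rank d i) l i = A l i by rewrite /partial ltnn andbF.
(* The inserted weights come from array [k], which the sweep never alters because [k != l]. *)
have part_k : partial (pos_rank d i) k i = A k i by rewrite /partial (negbTE kl).
pose z := (A l i * corner_sum pi d (A k) i)%N.
have zM : (z <= M)%N.
  apply: leq_trans BM; rewrite /z; apply: leq_trans (leq_mul (AB l i) (corner_sum_le pi d i (AB k))) _.
  by nia.
have ev : eval s4 (Bin Sub (Bin Mul (Bin Add (Mem (arr_expr l (Reg 6))) (Cst 1)) (Reg 5))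
    (Cst 1)) = z%:Z - 1.
  rewrite -[LHS]/((mem s4 (eval s4 (arr_expr l (Reg 6))) + 1) * regs s4 5 - 1).
  by rewrite el m4 harr part_i r45 /z; lia.
apply: runs_Seq; apply: runs_SetMem => //; rewrite ?el ev; first by lia.
move=> hs5; set s5 := set_mem s4 _ _ in hs5 *.
have m5pi (i' : 'I_n) : mem s5 i'.+1%:Z = (pi i').+1%:Z.
  rewrite /s5 /= m4 hpi; case: eqP => // -[h].
  by have := ltn_ord i'; move: h; rewrite /=; lia.
have m5seg g' p : mem s5 (seg_addr m g' p) = mem s (seg_addr m g' p).
  by rewrite /s5 /= eq_sym (negbTE (arr_seg_addr _ _ _ _ _ _)) m4.
have m5arr k' (i' : 'I_n) : mem s5 (arr_addr n k' i') = (partial (pos_rank d i).+1 k' i')%:Z - 1.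
  rewrite /s5 /= m4 harr partialS; case: eqP => [/arr_addr_inj [-> ->]|ne].
    by rewrite !eqxx.
  by case: andP => // -[/eqP kk /eqP ii]; rewrite kk ii in ne.
have e5 : eval s5 (leaf_expr d) = (m + val_rank d pi i)%:Z.
  by apply: eval_leaf => //; rewrite /s5 /= ?r4.
apply: runs_Seq; apply: runs_SetReg => //; rewrite e5 //.
move=> hs6; set s6 := set_reg s5 4 _ in hs6 *.
have ek : eval s6 (Bin Add (Mem (arr_expr k (Reg 6))) (Cst 1)) = (A k i)%:Z.
  rewrite -[LHS]/(mem s6 (eval s6 (arr_expr k (Reg 6))) + 1).
  rewrite (@eval_arr_expr s6 n k (Reg 6) i) //; last by rewrite /= r4.
  by rewrite -[mem s6 _]/(mem s5 _) m5arr partialS (negbTE kl) /= part_k; lia.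
apply: runs_Seq; apply: runs_SetReg => //; rewrite ek.
  by have := AB k i; nia.
move=> hs7; set s7 := set_reg s6 7 _ in hs7 *.
apply: runs_Seq.
have U := @update_loopP M g m L (tree (pos_rank d i)) s7 _ (A k i) hs7 _ erefl erefl node.
apply: runs_weaken (U _ _ _) => //.
- move=> s8 [hs8 r8 m8 m8seg]; rewrite expnS in m8 m8seg.
  have r8' x : (x < 4)%N -> regs s8 x = regs s x.
    move=> x4; rewrite r8 //= ?r4 //; try by lia.
    by do 2! (case: eqP => [?|_]; first by lia).
  have e3 : eval s8 (Bin Add (Reg 3) (Cst 1)) = (pos_rank d i).+1%:Z.
    by rewrite /= r8' // h3; lia.
  apply: runs_SetReg => //; rewrite e3; first by lia.
  move=> hs9; split=> //.
    split=> /=; rewrite ?r8' //.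
    + by move=> i'; rewrite m8 ?m5pi // => p hp; rewrite /seg_addr; lia.
    + move=> k' i'; rewrite m8; first exact: m5arr.
      by move=> p hp; apply/eqP/arr_seg_addr.
    + move=> g' p gg hp; rewrite m8; first by rewrite -[mem s7 _]/(mem s5 _) m5seg hfree.
      by move=> p' hp' /seg_addr_inj [] // ?; lia.
  by move=> p hp; rewrite /= m8seg // treeS.
- by rewrite /= r4.
- by move=> p; rewrite expnS -[mem s7 _]/(mem s5 _) m5seg; apply: hseg.
by move=> p _; have := tree_le (pos_rank d i) p; have := AB k i; nia.
Qed.

Lemma sweepP s : bounded M s -> layout pi m g A acc s ->
  runs M (sweep d k l g) s ((n * (7 * L + 13)) + 2) (fun s' =>
    bounded M s' /\ layout pi m g.+1 (sweep_array pi d k l A) acc s').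
Proof.
move=> hs lay; rewrite (_ : (_ + 2)%N = (1 + (n * (7 * L + 12).+1).+1)%N); last by lia.
have partial0 k' i : partial 0 k' i = A k' i by rewrite /partial ltn0 andbF.
apply: runs_Seq; apply: runs_SetReg => // hs1.
apply: runs_weaken (runs_While (I := inv) (N := n) _ _ _ _) => //.
- move=> s' [hs' [h0 h1 h2 hpi harr hfree] _ _]; split=> //; split=> // k' i.
  rewrite harr /partial /sweep_array; case: eqP => //= _.
  suff -> : (pos_rank d i < n)%N by [].
  by have := ltn_ord i; rewrite /pos_rank; case: ifP; lia.
- by move=> j s' _ [].
- move=> j s' jn hI; split; last exact: sweep_bodyP.
  by have [_ [h0 _ _ _ _ _] h3 _] := hI; rewrite /= h0 h3; lia.
- by move=> s' [_ [h0 _ _ _ _ _] h3 _]; rewrite /= h0 h3; lia.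
have [h0 h1 h2 hpi harr hfree] := lay.
split=> //.
  split=> //= [k' i|g' p gg hp]; first by rewrite partial0.
  by apply: hfree => //; lia.
move=> p hp; rewrite /= hfree // /tree big1 // => i _.
Qed.

End Sweep.

(** * Programs for trees and formulas *)

Lemma up_log2_le n : (up_log 2 n <= (trunc_log 2 n).+1)%N.
Proof. by apply: up_log_min => //; apply/ltnW/trunc_log_ltn. Qed.

(** Rounding up to a power of two at most doubles a positive number; the summand 1 covers
    [n = 0]. *)
Lemma expn_up_log2_le n : (2 ^ up_log 2 n <= 2 * n + 1)%N.
Proof.
case: n => [|n]; first by rewrite up_log0.
have h : (2 ^ up_log 2 n.+1 <= 2 ^ (trunc_log 2 n.+1).+1)%N.
  by rewrite leq_exp2l // up_log2_le.
have := @trunc_logP 2 n.+1 isT isT; move: h; rewrite expnS; lia.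
Qed.

Definition setup : prog :=
  Seq (SetReg 2 (Cst 1))
      (While (Bin Sub (Reg 0) (Reg 2)) (SetReg 2 (Bin Mul (Cst 2) (Reg 2)))).

Lemma setupP n (pi : 'S_n) M : (2 * 2 ^ up_log 2 n <= M)%N ->
  runs M setup (input_state pi) (2 * up_log 2 n + 2) (fun s =>
    bounded M s /\ layout pi (2 ^ up_log 2 n) 0 (fun _ _ => 1%N) 0 s).
Proof.
set L := up_log 2 n => hM.
have nL : (n <= 2 ^ L)%N by apply: up_logP.
have nM : (n <= M)%N by lia.
have input i : nth 0%N (one_line pi) i = (if insub i is Some j then (pi j).+1 else 0)%N.
  case: insubP => [j hj <-|hi].
    by rewrite (nth_map j) ?size_enum_ord ?ltn_ord // nth_ord_enum.
  by rewrite nth_default // size_map size_enum_ord leqNgt.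
have hs : bounded M (input_state pi).
  split=> [x|[[|a]|a]] //=; first by case: ifP.
  by rewrite input; case: insubP => // j _ _; apply: leq_trans nM; apply: ltn_ord.
rewrite (_ : (2 * L + 2)%N = (1 + (L * 2).+1)%N); last by lia.
apply: runs_Seq; apply: runs_SetReg => //; first by move: (expn_gt0 2 L) hM => /=; lia.
move=> hs1; pose I j s := [/\ bounded M s, regs s 0 = n%:Z, regs s 1 = 0,
  regs s 2 = (2 ^ j)%:Z & mem s = mem (input_state pi)].
apply: runs_weaken (runs_While (I := I) (N := L) _ _ _ _) => //.
- move=> s [b h0 h1 h2 hm]; split=> //; split=> //.
  + move=> i; rewrite hm /= input.
    by case: insubP (ltn_ord i) => [j _ /val_inj -> //|/negbTE ->].
  (* Array cells lie beyond the input and read 0, which encodes the entry 1. *)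
  + move=> k i; rewrite hm /= /arr_addr addnS input; case: insubP => // j hj _.
    by move: hj (ltn_ord i); nia.
  + move=> g' p _ hp; rewrite hm /seg_addr.
    by case: (2 * g' * 2 ^ L + p)%N (ltac:(lia) : (0 < 2 * g' * 2 ^ L + p)%N).
- by move=> j s _ [].
- move=> j s jL [b h0 h1 h2 hm].
  (* Minimality of [up_log] keeps the doubling going for exactly [L] rounds. *)
  have jn : (2 ^ j < n)%N by rewrite ltnNge; apply/negP=> /(up_log_min (ltnSn 1)); rewrite -/L; lia.
  split; first by rewrite /= h0 h2; lia.
  have e : eval s (Bin Mul (Cst 2) (Reg 2)) = (2 ^ j.+1)%:Z by rewrite /= h2 expnS.
  by apply: runs_SetReg => //; rewrite e expnS; lia.
- by move=> s [b h0 h1 h2 hm]; rewrite /= h0 h2; lia.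
Qed.

Definition sum_prog (a : int) (k : nat) : prog :=
  Seq (SetReg 3 (Cst 0))
      (While (Bin Sub (Reg 0) (Reg 3))
        (Seq (SetReg 1 (Bin Add (Reg 1)
               (Bin Mul (Cst a) (Bin Add (Mem (arr_expr k (Bin Add (Reg 3) (Cst 1)))) (Cst 1)))))
             (SetReg 3 (Bin Add (Reg 3) (Cst 1))))).

Lemma sum_progP n (pi : 'S_n) m g A acc a k M B s : (n <= M)%N ->
  (forall i, A k i <= B)%N -> (`|acc| + `|a| * (n * B) <= M)%N ->
  bounded M s -> layout pi m g A acc s ->
  runs M (sum_prog a k) s (n * 3 + 2) (fun s' => bounded M s' /\
    layout pi m g A (acc + a * (\sum_i A k i)%N%:Z) s').
Proof.
move=> nM AB hM hs lay; rewrite (_ : (n * 3 + 2)%N = (1 + (n * 3).+1)%N); last by lia.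
apply: runs_Seq; apply: runs_SetReg => // hs1.
pose S j := (\sum_(i < n) (i < j) * A k i)%N.
have S_le j : (S j <= n * B)%N by apply: leq_sum_bool.
pose I j s := [/\ bounded M s, layout pi m g A (acc + a * (S j)%:Z) s & regs s 3 = j%:Z].
apply: runs_weaken (runs_While (I := I) (N := n) _ _ _ _) => //.
- move=> s' [b l _]; split=> //; suff <- : S n = (\sum_i A k i)%N by [].
  by apply: eq_bigr => i _; rewrite ltn_ord mul1n.
- by move=> j s' _ [].
- move=> j s' jn [b l h3]; have [h0 h1 h2 hpi harr hseg] := l.
  split; first by rewrite /= h0 h3; lia.
  have SS : S j.+1 = (S j + A k (Ordinal jn))%N.
    rewrite /S (bigD1 (Ordinal jn)) //= [in RHS](bigD1 (Ordinal jn)) //= ltnSn ltnn.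
    rewrite mul1n mul0n add0n addnC; congr (_ + _)%N; apply: eq_bigr => i ne.
    by rewrite ltnS leq_eqVlt -[X in X || _]/(i == Ordinal jn) (negbTE ne).
  have e1 : eval s' (Bin Add (Reg 1) (Bin Mul (Cst a)
      (Bin Add (Mem (arr_expr k (Bin Add (Reg 3) (Cst 1)))) (Cst 1)))) =
      acc + a * (S j.+1)%:Z.
    rewrite -[LHS]/(regs s' 1 +
      a * (mem s' (eval s' (arr_expr k (Bin Add (Reg 3) (Cst 1)))) + 1)).
    rewrite (@eval_arr_expr s' n k _ (Ordinal jn)) //; last by rewrite /= h3; lia.
    by rewrite harr h1 SS PoszD; ring.
  rewrite (_ : 2%N = (1 + 1)%N) //; apply: runs_Seq; apply: runs_SetReg => //; rewrite e1.
    apply: leq_trans hM; have := S_le j.+1; move: (S j.+1) (n * B)%N => x y xy.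
    apply: leq_trans (_ : (`|acc| + `|a| * x <= _)%N); last by rewrite leq_add2l leq_mul2l xy orbT.
    by rewrite -[X in (_ <= _ + _ * X)%N](absz_nat x) -abszM; move: (a * x%:Z) => z; lia.
  move=> b2; apply: runs_SetReg => //=; rewrite h3; first by lia.
  move=> b3; split=> //=; last by lia.
- by move=> s' [b [h0 _ _ _ _ _] h3]; rewrite /= h0 h3; lia.
split=> //; have -> : S 0 = 0%N by rewrite /S big1.
by rewrite mulr0 addr0; apply: layout_regs lay => // x x3; rewrite /=; case: eqP => // ?; lia.
Qed.

Definition array_of (T : corner_tree) (o : nat) (v : ct_vertex T) : nat := (o + enum_rank v)%N.

Lemma array_of_inj T o : injective (@array_of T o).
Proof. by move=> u v /addnI /val_inj /enum_rank_inj. Qed.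

Fixpoint fold_prog (T : corner_tree) (o : nat) (vs : seq (ct_vertex T)) (g : nat) : prog :=
  if vs is v :: vs' then
    Seq (if ct_label v is Some d
         then sweep d (array_of o v) (array_of o (ct_parent v)) g else Skip)
        (fold_prog o vs' g.+1)
  else Skip.

(** Growth of exponents under one fold: a weight of size [N ^ a] is multiplied by a sum of at most
    [n] such weights, which stays below [N ^ (2 * a + 1)] for [N = n + 2]. *)
Definition grow (a : nat) : nat := (2 * a + 1)%N.

Lemma leq_iter_grow r a : (a <= iter r grow a)%N.
Proof. by elim: r => //= r; move: (iter r grow a) => b; rewrite /grow; lia. Qed.

(** The exponent in the size bound depends on the number of stripped vertices but not on [n]. The
    last conclusion keeps the arrays reserved for later trees intact. *)
Lemma fold_progP n (pi : 'S_n) L M T o (vs : seq (ct_vertex T)) g a A acc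
    (X : ct_vertex T -> 'I_n -> nat) s :
  (n <= 2 ^ L)%N -> (2 * 2 ^ L <= M)%N -> (n.+2 ^ iter (size vs) grow a <= M)%N ->
  leaf_order vs -> (forall v i, A (array_of o v) i = X v i) ->
  (forall k i, A k i <= n.+2 ^ a)%N ->
  bounded M s -> layout pi (2 ^ L) g A acc s ->
  runs M (fold_prog o vs g) s (size vs * (n * (7 * L + 13) + 2) + 1) (fun s' =>
    exists A', [/\ bounded M s', layout pi (2 ^ L) (g + size vs) A' acc s',
      forall v i, A' (array_of o v) i = foldl (fold_leaf pi) X vs v i,
      forall k i, (A' k i <= n.+2 ^ iter (size vs) grow a)%N &
      forall k i, (o + #|ct_vertex T| <= k)%N -> A' k i = A k i]).
Proof.
move=> nL LM; elim: vs g a A X s => [|v vs IH] g a A X s hM ho hX hA hs lay.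
  by apply: runs_Skip; exists A; rewrite addn0; split.
move: ho => /= /and5P[vr _ _ _ ho].
rewrite mulSn -addnA; apply: runs_Seq.
case hd: (ct_label v) => [d|]; last by move/ct_label_root/eqP: hd; rewrite (negbTE vr).
rewrite [size _]/= iterSr in hM.
have gM : (n.+2 ^ grow a <= M)%N.
  by apply: leq_trans hM; rewrite leq_exp2l // leq_iter_grow.
have step : (n.+1 * n.+2 ^ a * n.+2 ^ a <= n.+2 ^ grow a)%N.
  rewrite /grow mul2n -addnn !expnD expn1 -mulnA mulnC leq_mul2l.
  by rewrite leqnSn orbT.
apply: runs_weaken (@sweepP n pi L M (n.+2 ^ a) d _ _ g A acc nL LM _ _ hA _ s hs lay) => //.
- move=> s1 [hs1 lay1].
  apply: runs_weaken (IH _ (grow a) _ (fold_leaf pi X v) s1 hM ho _ _ hs1 lay1) => //.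
  + move=> s2 [A' [b1 b2 b3 b4 b5]]; exists A'; split=> //.
    * by rewrite addnS -addSn.
    * by move=> k i; rewrite -iterS iterSr.
    move=> k i hk; rewrite b5 // /sweep_array; case: eqP => // kk.
    by move: hk; rewrite kk /array_of leq_add2l leqNgt ltn_ord.
  + move=> u i; rewrite /sweep_array /fold_leaf hd (inj_eq (@array_of_inj T o)).
    case: eqP => [->|_]; last exact: hX.
    by rewrite hX; congr (_ * _)%N; apply: eq_bigr => j _; rewrite hX.
  + move=> k i; apply: leq_trans step; rewrite /sweep_array; case: ifP => _.
      apply: leq_trans (leq_mul (hA _ _) (corner_sum_le _ _ _ (hA _))) _.
      by nia.
    by apply: leq_trans (hA k i) _; have := expn_gt0 n.+2 a; nia.
- by rewrite expn_gt0.
- exact: leq_trans step gM.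
- by rewrite (inj_eq (@array_of_inj T o)) eq_sym ct_parent_neq.
Qed.

(** * Integer combinations of tree counts *)

Definition int_formula_value (F : seq (int * corner_tree)) n (pi : 'S_n) : int :=
  \sum_(aT <- F) aT.1 * (occurrences aT.2 pi)%:Z.

Lemma formula_clear_denominators (F : corner_tree_formula) :
  exists (D : nat) (F' : seq (int * corner_tree)), (0 < D)%N /\
    forall n (pi : 'S_n),
      D%:R * formula_value F pi = (int_formula_value F' pi)%:~R.
Proof.
elim: F => [|[c T] F [D [F' [D0 hF]]]].
  by exists 1%N, [::]; split=> // n pi; rewrite /formula_value /int_formula_value !big_nil mulr0.
exists (D * `|denq c|)%N,
  ((numq c * D%:Z, T) :: [seq (denq c * aT.1, aT.2) | aT <- F']); split.
  by rewrite muln_gt0 D0 absz_gt0 denq_neq0.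
move=> n pi; rewrite /formula_value /int_formula_value !big_cons big_map /=.
have dE : (`|denq c|%N)%:R = (denq c)%:~R :> rat.
  by rewrite pmulrn gez0_abs // ltW // denq_gt0.
rewrite mulrDr rmorphD natrM; congr (_ + _).
  by rewrite !rmorphM /= -!pmulrn dE numqE; ring.
under [in RHS]eq_bigr do rewrite -mulrA.
by rewrite -mulr_sumr rmorphM /= -hF dE /formula_value; ring.
Qed.

(** The program and both constants are chosen before [n]. From number [o] on, arrays consist of ones
    and segment trees are empty; [a] bounds the size of what earlier trees left behind. Both grow
    along the formula. *)
Lemma formula_progP (F : seq (int * corner_tree)) : forall o a : nat,
  exists (p : prog) (E0 C : nat), forall n (pi : 'S_n) L M A acc s,
    (n <= 2 ^ L)%N -> (2 * 2 ^ L <= M)%N -> (n.+2 ^ E0 <= M)%N ->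
    (forall k i, (o <= k)%N -> A k i = 1%N) ->
    (forall k i, (A k i <= n.+2 ^ a)%N) -> (`|acc| <= n.+2 ^ a)%N ->
    bounded M s -> layout pi (2 ^ L) o A acc s ->
    runs M p s (C * (n.+1 * L.+1)) (fun s' => bounded M s' /\
      regs s' 1 = acc + int_formula_value F pi).
Proof.
elim: F => [|[c T] F IH] o a.
  exists Skip, 0%N, 1%N => n pi L M A acc s _ _ _ _ _ _ hs lay.
  apply: (runs_le (k := 1)); first by rewrite mul1n muln_gt0.
  by apply: runs_Skip; rewrite (lay_acc lay) /int_formula_value big_nil addr0.
have [vs ho hvs] := leaf_order_exists T.
set r := size vs; pose a1 := iter r grow a.
(* With [N = n + 2], the new term is at most [N ^ |c| * N * N ^ a1], and the old accumulator at most
   [N ^ a]; one more factor [N] pays for adding the two. *)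
pose a2 := (a + `|c| + a1 + 2)%N.
(* The shift passes both the [#|ct_vertex T|] arrays and the [r] segment trees used for [T], so that
   one offset serves for both. *)
have [p [E0 [C hp]]] := IH (o + #|ct_vertex T| + r)%N a2.
exists (Seq (fold_prog o vs o) (Seq (sum_prog c (array_of o (ct_root T))) p)),
  (E0 + a2)%N, (r * 15 + 6 + C)%N.
move=> n pi L M A acc s nL LM hM hfresh hA hacc hs lay.
have M1 e : (e <= E0 + a2)%N -> (n.+2 ^ e <= M)%N.
  by move=> he; apply: leq_trans hM; rewrite leq_exp2l.
apply: (runs_le (k := (r * (n * (7 * L + 13) + 2) + 1) +
  ((n * 3 + 2) + C * (n.+1 * L.+1)))).
  rewrite -/r [leqRHS]mulnDl addnA leq_add2r.
  have : (n * (7 * L + 13) + 2 <= 15 * (n.+1 * L.+1))%N by nia.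
  move=> /(leq_mul (leqnn r)); nia.
apply: runs_Seq.
apply: runs_weaken (@fold_progP n pi L M T o vs o a A acc (fun _ _ => 1%N) s nL LM
  _ ho _ hA hs lay) => //; first last.
- by move=> v i; apply: hfresh; rewrite leq_addr.
- by apply: M1; rewrite -/r -/a1 /a2; lia.
rewrite -/r -/a1 => s1 [A' [hs1 lay1 hX hA' hfr]].
have acc_le : (`|acc| + `|c| * (n * n.+2 ^ a1) <= n.+2 ^ a2)%N.
  have c_le : (`|c| <= n.+2 ^ `|c|)%N by apply/ltnW/ltn_expl.
  have h1 : (`|c| * (n * n.+2 ^ a1) <= n.+2 ^ (a + `|c| + a1 + 1))%N.
    rewrite !expnD expn1; apply: leq_trans (leq_mul c_le (leqnn _)) _.
    have := expn_gt0 n.+2 a; move: (n.+2 ^ a)%N (n.+2 ^ `|c|)%N (n.+2 ^ a1)%N => x y z.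
    move=> /= x0; have -> : (x * y * z * n.+2 = x * (y * z * n.+2))%N by ring.
    by apply: leq_trans (leq_pmull _ x0); nia.
  have h2 : (n.+2 ^ a <= n.+2 ^ (a + `|c| + a1 + 1))%N by rewrite leq_exp2l //; lia.
  apply: leq_trans (leq_add (leq_trans hacc h2) h1) _.
  rewrite /a2 (_ : (a + `|c| + a1 + 2)%N = (a + `|c| + a1 + 1).+1); last by lia.
  by rewrite expnS; nia.
apply: runs_Seq.
apply: runs_weaken (@sum_progP n pi _ _ A' acc c _ M _ s1 _ (hA' _) _ hs1 lay1) => //.
- move=> s2 [hs2 lay2].
  rewrite -(eq_bigr _ (fun i _ => esym (hX (ct_root T) i))) -(occurrences_foldl pi ho hvs) in lay2.
  apply: runs_weaken (hp n pi L M A' _ s2 nL LM _ _ _ _ hs2 _) => //.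
  + move=> s3 [hs3 h1]; split=> //.
    by rewrite h1 /int_formula_value big_cons addrA.
  + by apply: M1; lia.
  + by move=> k i hk; rewrite hfr ?hfresh //; lia.
  + by move=> k i; apply: leq_trans (hA' k i) _; rewrite leq_exp2l // /a2; lia.
  + apply: leq_trans acc_le.
    apply: leq_trans (_ : (`|acc| + `|c| * occurrences T pi <= _)%N).
      by rewrite -[X in (_ <= _ + _ * X)%N](absz_nat (occurrences T pi)) -abszM; move: (c * _) => z; lia.
    rewrite leq_add2l leq_mul2l (occurrences_foldl pi ho hvs); apply/orP; right.
    apply: leq_trans (_ : (\sum_(i < n) n.+2 ^ a1 <= _)%N).
      by apply: leq_sum => i _; rewrite -hX.
    by rewrite sum_nat_const card_ord.
  by apply: layout_le lay2; lia.
- by lia.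
- by apply: leq_trans acc_le _; apply: M1; lia.
Qed.

(** For [n > 1] the logarithm [l] is at least 1, so that [n + 2 <= 2 ^ (l + 2) <= 2 ^ (3 * l)]. *)
Lemma bitlen_expn_le n E : (1 < n)%N ->
  (bitlen (n.+2 ^ E)%N%:Z <= (3 * E + 1) * trunc_log 2 n)%N.
Proof.
move=> n1; have lg0 : (0 < trunc_log 2 n)%N by rewrite trunc_log_gt0 n1.
apply: leq_trans (_ : (3 * trunc_log 2 n * E + 1 <= _)%N); last by nia.
apply: bitlen_leq; rewrite ?addn1 //= expnS.
have : (n.+2 <= 2 ^ (3 * trunc_log 2 n))%N.
  have hn := @trunc_log_ltn 2 n isT.
  apply: leq_trans (_ : (2 ^ (trunc_log 2 n).+2 <= _)%N); last by rewrite leq_exp2l //; lia.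
  by rewrite expnS; lia.
move=> h; have h' : (n.+2 ^ E <= 2 ^ (3 * trunc_log 2 n * E))%N.
  by rewrite expnM; case: E => // e; rewrite leq_exp2r.
by have := expn_gt0 2 (3 * trunc_log 2 n * E); lia.
Qed.

Theorem theorem1 (F : corner_tree_formula) (f : forall n : nat, 'S_n -> int)
    (hf : forall (n : nat) (pi : 'S_n), (f n pi)%:~R = formula_value F pi) :
  exists (p : prog) (t : nat -> nat),
    computes_in_time p f t /\ softO t (fun n => n).
Proof.
have [D [F' [D0 hF]]] := formula_clear_denominators F.
(* Since [f] takes integer values, the final division by [D] is exact. *)
have {hf hF} fE n (pi : 'S_n) : int_formula_value F' pi = f n pi * D%:Z.
  by apply: (@intr_inj rat); rewrite -hF -hf rmorphM /= mulrC.
have [q [E0 [C hq]]] := formula_progP F' 0 0.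
pose p := Seq setup (Seq q (SetReg 0 (Bin Div (Reg 1) (Cst D%:Z)))).
(* The extra 2 makes room for the tree size: [2 * 2 ^ L <= 4 * n + 2 <= (n + 2) ^ 2]. *)
pose E := (E0 + 2)%N.
pose steps n := (2 * up_log 2 n + 2 + (C * (n.+1 * (up_log 2 n).+1) + 1))%N.
exists p, (fun n => steps n * (prog_cost p * bitlen (n.+2 ^ E)%N%:Z))%N; split.
  move=> n pi; set L := up_log 2 n; set M := (n.+2 ^ E)%N.
  have LM : (2 * 2 ^ L <= M)%N.
    apply: leq_trans (_ : (n.+2 ^ 2 <= _)%N); last by rewrite leq_exp2l // leq_addl.
    by have := expn_up_log2_le n; rewrite -/L; nia.
  suff [k [s [hk kle hs]]] : runs M p (input_state pi) (steps n) (fun s => regs s 0 = f n pi).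
    have [t ht tle] := exec_of_uexec hk; exists t, s; split=> //.
    by apply: leq_trans tle _; rewrite leq_mul2r kle orbT.
  apply: runs_Seq; apply: runs_weaken (setupP pi LM) => // s1 [hs1 lay1].
  apply: runs_Seq; apply: runs_weaken (hq n pi L M _ _ s1 _ LM _ _ _ _ hs1 lay1) => //.
  - move=> s2 [hs2 h1].
    have ev : eval s2 (Bin Div (Reg 1) (Cst D%:Z)) = f n pi.
      by rewrite /= h1 add0r fE mulzK // -lt0n.
    apply: runs_SetReg => //; rewrite ev // -ev /=.
    exact: leq_trans (absz_divz_le _ _) (hs2.1 1%N).
  - exact: up_logP.
  - by rewrite leq_exp2l // leq_addr.
(* One logarithm comes from the depth of the segment trees, the other from the bit length of the
   numbers; from [n = 2] on the logarithm is positive and absorbs constants. *)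
exists ((6 * C + 13) * prog_cost p * (3 * E + 1))%N, 2%N, 2%N => n n1.
have lg0 : (0 < trunc_log 2 n)%N by rewrite trunc_log_gt0 n1.
have hsteps : (steps n <= (6 * C + 13) * (n * trunc_log 2 n))%N.
  have hL := up_log2_le n; rewrite /steps.
  move: (up_log 2 n) (trunc_log 2 n) hL lg0 => L l hL l0.
  have h1 : (n.+1 * L.+1 <= 6 * (n * l))%N by nia.
  have h2 : (2 * L + 3 <= 13 * (n * l))%N by nia.
  by have := leq_mul (leqnn C) h1; nia.
apply: leq_trans (leq_mul hsteps (leq_mul (leqnn _) (bitlen_expn_le E n1))) _.
by rewrite eq_leq //; ring.
Qed.
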